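(* Let $J:\mathbb{R}^n\to[0,\infty)$ be convex, lower semicontinuous and absolutely one-homogeneous, and let $f\in\mathbb{R}^n$. Then $$ f = P_0(f) + \int_0^\infty \phi_{GF}(t)\,dt, $$ where the integral denotes the vector in $\mathbb{R}^n$ whose inner product with any $g\in\mathbb{R}^n$ is the value of the functional $\phi_{GF}$ at the constant test function $v\equiv g$.
   Context: $\langle\cdot,\cdot\rangle$ (also written $\cdot$) and $\|\cdot\|$ are the Euclidean inner product and norm on $\mathbb{R}^n$. Absolutely one-homogeneous means $J(su)=|s|J(u)$ for all $s\in\mathbb{R}$, $u\in\mathbb{R}^n$. The nullspace $\mathcal{N}(J)=\{u: J(u)=0\}$ is a linear subspace, and $P_0$ is the orthogonal projection onto it. $u_{GF}:[0,\infty)\to\mathbb{R}^n$ is the solution of the gradient flow $\partial_t u_{GF}(t)=-p_{GF}(t)$, $p_{GF}(t)\in\partial J(u_{GF}(t))$ for a.e. $t>0$, $u_{GF}(0)=f$, where $\partial J$ is the convex subdifferential; $u_{GF}$ is Lipschitz and constant for large $t$. The spectral (wavelength) representation $\phi_{GF}(t)=t\,\partial_{tt}u_{GF}(t)$ is understood as the linear functional on test functions $v\in W^{1,1}_{loc}([0,\infty);\mathbb{R}^n)$ given by $$ v\mapsto \int_0^\infty v(t)\cdot\phi_{GF}(t)\,dt := -\int_0^\infty \big(t\,\partial_t v(t)+v(t)\big)\cdot\partial_t u_{GF}(t)\,dt. $$ *)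

(* Defs.v *)
(* R^n is the space 'rV[R]_n of row vectors. *)
From HB Require Import structures.
From mathcomp Require Import all_boot all_order all_algebra.
From mathcomp Require Import all_classical all_reals all_analysis.

Set Implicit Arguments.
Unset Strict Implicit.
Unset Printing Implicit Defensive.

Import Order.TTheory GRing.Theory Num.Theory.
Import numFieldNormedType.Exports.

Local Open Scope classical_set_scope.
Local Open Scope ring_scope.

Definition dot (R : realType) (n : nat) (x y : 'rV[R]_n) : R :=
  \sum_(i < n) x ord0 i * y ord0 i.

Definition abs_one_homogeneous (R : realType) (n : nat) (J : 'rV[R]_n -> R) :=
  forall (s : R) (x : 'rV[R]_n), J (s *: x) = `|s| * J x.

Definition nullspace (R : realType) (n : nat) (J : 'rV[R]_n -> R) :
  set 'rV[R]_n := [set x | J x = 0].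

(* The y in N with x - y orthogonal to N; the default 0 is used only when no
   such y exists, which does not happen for a linear subspace N. *)
Definition orth_proj (R : realType) (n : nat) (N : set 'rV[R]_n)
    (x : 'rV[R]_n) : 'rV[R]_n :=
  xget 0 [set y | N y /\ forall z, N z -> dot (x - y) z = 0].

Definition subdifferential (R : realType) (n : nat) (J : 'rV[R]_n -> R)
    (x : 'rV[R]_n) : set 'rV[R]_n :=
  [set p | forall y, J x + dot p (y - x) <= J y].

(* Only the restriction of u to [0, +oo[ matters. The norm in the Lipschitz
   condition is the sup norm of 'rV[R]_n, which is equivalent to the Euclidean
   one. The subgradient p(t) is - u'(t). *)
Definition gradient_flow (R : realType) (n : nat) (J : 'rV[R]_n -> R)
    (f : 'rV[R]_n) (u : R -> 'rV[R]_n) : Prop :=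
  [/\ [lipschitz u t | t in `[0, +oo[],
      u 0 = f &
      {ae lebesgue_measure, forall t : R, 0 < t ->
        derivable u t 1 /\ subdifferential J (u t) (- derive1 u t)}].

(* The functional v |-> \int_0^oo v . phi dt for phi = t u'', on test functions
   v in W^{1,1}_loc([0, +oo[; R^n), taken in their locally absolutely continuous
   representative: the derivative of v then exists a.e. in the classical sense
   and is its weak derivative. The value is extended-real so that a finite
   value really means a convergent integral. *)
Definition spectral_functional (R : realType) (n : nat) (u : R -> 'rV[R]_n)
    (v : R -> 'rV[R]_n) : \bar R :=
  (- \int[lebesgue_measure]_(t in `[0%R, +oo[)
       (dot (t *: derive1 v t + v t) (derive1 u t))%:E)%E.

(* w is the vector \int_0^oo phi dt. Such a w is unique, [dot] being
   nondegenerate. *)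
Definition is_spectral_integral (R : realType) (n : nat) (u : R -> 'rV[R]_n)
    (w : 'rV[R]_n) : Prop :=
  forall g : 'rV[R]_n, (dot w g)%:E = spectral_functional u (fun=> g).

(* Main.v *)
Require Import Defs.
From HB Require Import structures.
From mathcomp Require Import all_boot all_order all_algebra.
From mathcomp Require Import all_classical all_reals all_analysis.
From mathcomp Require Import measurable_realfun ring lra.

Set Implicit Arguments.
Unset Strict Implicit.
Unset Printing Implicit Defensive.

Import Order.TTheory GRing.Theory Num.Theory.
Import numFieldNormedType.Exports.

Local Open Scope classical_set_scope.
Local Open Scope ring_scope.

(** The constant test function [g] has zero derivative, so the functional at [g]
is [- \int_0^oo u' . g], and the theorem says that [u] travels from [f] to the
projection [y0] of [f] onto the nullspace [N] of [J], with an integrable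
velocity. Three facts carry the proof.

- [J] is a seminorm on R^n: convexity and homogeneity give the triangle
  inequality ([subadditive]). Hence [J] is continuous, [y0] exists
  ([orth_proj_nullspace]), and compactness of the unit sphere of the orthogonal
  complement of [N] gives [c > 0] with [c |x| <= J x] on that complement
  ([orthogonal_coercive]).
- The flow stops at [y0] in finite time ([finite_extinction]). Subgradients are
  orthogonal to [N], so [w := u - y0] stays orthogonal to [N]; and
  [(|w|^2)' = - 2 p . w <= - 2 J w <= - 2 c |w|], so that [|w|] decreases at
  rate at least [c] until it vanishes.
- A Lipschitz function is the integral of its derivative ([lipschitz_FTC]).
  Applied to [u . g] on [[0, T]] with [u T = y0] it gives
  [- \int_0^T u' . g = (f - y0) . g], and [u' = 0] after [T].

The derivative of the flow is only known to exist almost everywhere, and its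
default values elsewhere need not form a Borel function. Integrals are therefore
compared through [eq_integral_ae], which holds for arbitrary functions. *)

(** * Integrals of functions that agree almost everywhere *)

Section integral_ae.
Import HBNNSimple.

(** No measurability is assumed: the integral of a nonnegative function is a
supremum over the simple functions below it, and a simple function below [f]
can be set to zero on a negligible set, which keeps its integral and puts it
below [g]. *)
Lemma ge0_le_integral_ae d (T : measurableType d) (R : realType)
    (mu : {measure set T -> \bar R}) (f g : T -> \bar R) :
  (forall x, 0 <= f x)%E -> (forall x, 0 <= g x)%E ->
  {ae mu, forall x, f x = g x} -> (\int[mu]_x f x <= \int[mu]_x g x)%E.
Proof.
move=> f0 g0 [N [mN N0 fgN]].
rewrite !ge0_integralTE//; apply: ge_ereal_sup => _ [h hf <-].
have mNc : measurable (~` N) by exact: measurableC.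
rewrite -integralT_nnsfun (ge0_negligible_integral mN _ _ _ N0)//; last 2 first.
  by apply/measurable_EFinP; exact: measurable_funP.
  by move=> x _; rewrite lee_fin.
rewrite integral_mkcond.
have -> : (fun x => (h x)%:E) \_ (setT `\` N)
    = (fun x => (proj_nnsfun h mNc x)%:E).
  apply/funext => x; rewrite patchE setTD /proj_nnsfun /= mindicE.
  by case: ifPn => _; rewrite ?mulr1 ?mulr0.
rewrite integralT_nnsfun.
apply: ereal_sup_ubound; exists (proj_nnsfun h mNc) => //= x.
have [Nx|Nx] := pselect (N x).
  by rewrite mindicE memNset ?mulr0//; exact.
rewrite mindicE mem_set//= mulr1.
suff <- : f x = g x by exact: hf.
by apply: contrapT => fgx; exact/Nx/fgN.
Qed.

End integral_ae.

(** The two domains may differ, so that half-lines can be traded for intervals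
when the integrand vanishes on the difference. *)
Lemma eq_integral_ae d (T : measurableType d) (R : realType)
    (mu : {measure set T -> \bar R}) (D E : set T) (f g : T -> \bar R) :
  {ae mu, forall x, (f \_ D) x = (g \_ E) x} ->
  (\int[mu]_(x in D) f x = \int[mu]_(x in E) g x)%E.
Proof.
move=> fg; rewrite integral_mkcond [RHS]integral_mkcond.
rewrite integralE [RHS]integralE; congr (_ - _)%E; apply/eqP; rewrite eq_le.
  by apply/andP; split; apply: ge0_le_integral_ae => //;
    apply: filterS fg => x fgx; rewrite !funeposE fgx.
by apply/andP; split; apply: ge0_le_integral_ae => //;
  apply: filterS fg => x fgx; rewrite !funenegE fgx.
Qed.

Lemma ae_neq (R : realType) (a : R) :
  {ae lebesgue_measure, forall t : R, t <> a}.
Proof.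
exists [set a]; split; [exact: measurable_set1|exact: lebesgue_measure_set1|].
by move=> t /= /contrapT.
Qed.

(** The carrier of [lebesgue_measure] is a generated sigma-algebra on an alias of
[R], for which instance resolution does not find the generic filter. *)
#[local] Instance lebesgue_ae_filter (R : realType) :
  Filter (almost_everywhere (@lebesgue_measure R)).
Proof. exact: (@ae_filter_ringOfSetsType _ (measurableTypeR R)). Qed.

(** * The fundamental theorem of calculus for Lipschitz functions *)

Section FTC.
Context (R : realType).
#[local] Notation mu := (@lebesgue_measure R).
Context (F : R -> R) (L : R)
  (F_lip : forall x y, `|F x - F y| <= L * `|x - y|).

Lemma lipschitz_continuous : continuous F.
Proof.
move=> x; apply/cvgrPdist_le => e e0.
have L0 : 0 < `|L| + 1 by rewrite ltr_wpDl.
near=> y; apply: le_trans (F_lip x y) _.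
apply: le_trans (ler_wpM2r (normr_ge0 _) _) _; first exact: (ler_norm L).
apply: (@le_trans _ _ ((`|L| + 1) * `|x - y|)).
  by rewrite ler_wpM2r// lerDl.
rewrite mulrC -ler_pdivlMr//.
by near: y; apply: cvgr_dist_le => //; rewrite divr_gt0.
Unshelve. all: by end_near. Qed.

Lemma lipschitz_antiderivative (a b : R) : exists H : R -> R,
  forall x, a <= x <= b -> is_derive x 1 H (F x).
Proof.
exists (fun x => \int[lebesgue_measure]_(t in `[a - 1, x]) F t).
move=> x /andP[ax xb].
have [||||dH <-] := @continuous_FTC1_closed R F (a - 1) x (b + 1).
- by rewrite (le_lt_trans xb)// ltrDl.
- apply: continuous_compact_integrable; first exact: segment_compact.
  by apply: continuous_subspaceT => ?; exact: lipschitz_continuous.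
- by rewrite ltrBlDr (le_lt_trans ax)// ltrDl.
- exact: lipschitz_continuous.
by rewrite derive1E; exact: derivableP.
Qed.

(** The difference quotients [D n] of [F] with step [h = 1/(n+1)] are bounded by
[L] and converge almost everywhere to the derivative. Their integral from
[a] to [b] is, for an antiderivative [H] of [F],
[(H (b + h) - H b) / h - (H (a + h) - H a) / h], which tends to [F b - F a]. *)
Lemma lipschitzT_FTC (G : R -> R) (a b : R) : a < b ->
  {ae mu, forall t, a < t < b -> is_derive (t : R) 1 F (G t)} ->
  (\int[mu]_(t in `]a, b[) (G t)%:E = (F b - F a)%:E)%E.
Proof.
move=> ab FG; pose D n t := n.+1%:R * (F (t + n.+1%:R^-1) - F t).
have h_gt0 n : 0 < n.+1%:R^-1 :> R by rewrite invr_gt0.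
have cD n : continuous (D n).
  move=> t; apply: cvgM; first exact: cvg_cst.
  apply: cvgB; last exact: lipschitz_continuous.
  apply: continuous_cvg; first exact: lipschitz_continuous.
  by apply: cvgD; [exact: cvg_id | exact: cvg_cst].
have mD n : measurable_fun `]a, b[ (EFin \o D n).
  apply/measurable_EFinP; apply: measurable_funTS.
  exact: continuous_measurable_fun.
have cvgD (K : R -> R) t l : is_derive (t : R) 1 K l ->
    (fun n => n.+1%:R * (K (t + n.+1%:R^-1) - K t)) @ \oo --> l.
  move=> [/cvg_ex[/= l' Kl'] <-]; have -> : 'D_1 K t = l' by apply/cvg_lim.
  have h0 : (fun n => n.+1%:R^-1 : R) @ \oo --> (0 : R)^'.
    move=> A /(@cvg_harmonic R) hA.
    have {}hA : \forall n \near \oo, n.+1%:R^-1 != 0 :> R -> A n.+1%:R^-1 := hA.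
    by apply: filterS hA => n; apply; exact/lt0r_neq0/h_gt0.
  have := cvg_comp _ _ h0 Kl'.
  apply: cvg_trans; apply: near_eq_cvg; apply: nearW => n /=.
  by rewrite invrK scaler1 [_^-1 + t]addrC.
have [H dH] := lipschitz_antiderivative a (b + 1).
have intD n : (\int[mu]_(t in `]a, b[) (D n t)%:E =
    (n.+1%:R * (H (b + n.+1%:R^-1) - H b) -
     n.+1%:R * (H (a + n.+1%:R^-1) - H a))%:E)%E.
  pose P t := n.+1%:R * (H (t + n.+1%:R^-1) - H t).
  have dP t : a <= t <= b -> is_derive (t : R) 1 P (D n t).
    move=> /andP[at_ tb]; rewrite /D -[_ * _]/(_ *: _).
    apply: is_deriveZ; apply: is_deriveB; last first.
      by apply: dH; rewrite at_ ler_wpDr.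
    have dHt : is_derive (t + n.+1%:R^-1) 1 H (F (t + n.+1%:R^-1)).
      apply: dH; apply/andP; split; first by rewrite ler_wpDr// ltW.
      by rewrite lerD// invf_le1 ?ltr0n// ler1n.
    have := @is_derive1_comp R H (shift n.+1%:R^-1) t _ _ dHt
      (is_derive_shift t 1 n.+1%:R^-1).
    by rewrite mulr1.
  have -> : n.+1%:R * (H (b + n.+1%:R^-1) - H b) = P b by [].
  have -> : n.+1%:R * (H (a + n.+1%:R^-1) - H a) = P a by [].
  rewrite -(@integral_itv_bndoo _ _ _ _ true false); last exact: mD.
  rewrite (@continuous_FTC2 _ (D n) P)//.
  + by apply: continuous_subspaceT => ?; exact: cD.
  + have cP t : a <= t <= b -> {for t, continuous P}.
      move=> tab; apply: differentiable_continuous; apply/derivable1_diffP.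
      by case: (dP t tab).
    split.
    * move=> t; rewrite in_itv/= => /andP[? ?].
      by case: (dP t _) => //; rewrite !ltW.
    * by apply: cvg_at_right_filter; apply: cP; rewrite lexx ltW.
    * by apply: cvg_at_left_filter; apply: cP; rewrite lexx ltW.
  + move=> t; rewrite in_itv/= => /andP[? ?]; rewrite derive1E.
    by case: (dP t _) => //; rewrite !ltW.
(* The limit superior is a measurable substitute for [G]. *)
pose G' t := limn_esup (fun n => (D n t)%:E).
have mG' : measurable_fun `]a, b[ G' by exact: measurable_fun_limn_esup.
have DG : {ae mu, forall t, a < t < b ->
    (fun n => (D n t)%:E) @ \oo --> G' t /\ G' t = (G t)%:E}.
  apply: filterS FG => t FGt /FGt/cvgD DGt.
  have {}DGt : (fun n => (D n t)%:E) @ \oo --> (G t)%:E.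
    by apply: cvg_EFin => //; exact: nearW.
  suff -> : G' t = (G t)%:E by [].
  rewrite /G' is_cvg_limn_esupE; first exact/cvg_lim.
  by apply/cvg_ex; exists (G t)%:E.
have DL : {ae mu, forall t n, `]a, b[%classic t -> (`|(D n t)%:E| <= L%:E)%E}.
  apply: nearW => t n _ /=; rewrite lee_fin /D normrM gtr0_norm ?ltr0n//.
  rewrite -ler_pdivlMl ?ltr0n// mulrC (le_trans (F_lip _ _))//.
  by rewrite addrAC subrr add0r gtr0_norm.
have [||||||_ _ intG'] := @dominated_convergence _ _ R mu `]a, b[ _
    (fun n => EFin \o D n) G' (EFin \o cst L).
- by [].
- exact: mD.
- exact: mG'.
- by apply: filterS DG => t DGt; rewrite /= in_itv/= => /DGt[].
- apply: measurable_bounded_integrable => //.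
  + have : (@lebesgue_measure R `]a, b[%classic < +oo)%E.
      by rewrite lebesgue_measure_itv/= lte_fin ab -EFinB ltry.
    exact.
  + by exists `|L|; split => //= M LM t _; exact: ltW.
- exact: DL.
transitivity (\int[mu]_(t in `]a, b[) G' t)%E.
  apply: eq_integral_ae; apply: filterS DG => t DGt.
  rewrite !patchE; case: ifPn => //; rewrite inE /= in_itv/= => /DGt[_ ->//].
apply: cvg_unique intG' _ => //.
suff intD_cvg : (fun n => (n.+1%:R * (H (b + n.+1%:R^-1) - H b) -
    n.+1%:R * (H (a + n.+1%:R^-1) - H a))%:E) @ \oo --> (F b - F a)%:E.
  apply: cvg_trans intD_cvg; apply: near_eq_cvg; apply: nearW => n.
  exact/esym/intD.
apply: cvg_EFin; first by exact: nearW.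
apply: cvgB; apply: cvgD; apply: dH.
  by rewrite ltW//= lerDl.
by rewrite lexx/= ltW// ltr_wpDr.
Qed.

End FTC.

Lemma is_derive_interval_eq (R : realType) (F K : R -> R) (a b t d : R) :
  a < t < b -> (forall x, a <= x <= b -> F x = K x) ->
  is_derive t 1 F d -> is_derive t 1 K d.
Proof.
move=> /andP[at_ tb] FK; apply: near_eq_is_derive; near=> x; apply: FK.
apply/andP; split; apply: ltW.
- by near: x; exact: lt_nbhsr.
- by near: x; exact: lt_nbhsl.
Unshelve. all: by end_near. Qed.

(** Composing [F] with the retraction of the line onto [[a, b]] makes it
Lipschitz everywhere without changing its derivative inside. *)
Lemma lipschitz_FTC (R : realType) (F G : R -> R) (L a b : R) : a < b ->
  (forall x y, a <= x <= b -> a <= y <= b -> `|F x - F y| <= L * `|x - y|) ->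
  {ae lebesgue_measure, forall t : R, a < t < b -> is_derive t 1 F (G t)} ->
  (\int[lebesgue_measure]_(t in `]a, b[) (G t)%:E = (F b - F a)%:E)%E.
Proof.
move=> ab F_lip FG.
pose c x := Num.max a (Num.min b x).
have cab x : a <= c x <= b.
  rewrite /c /Num.max /Num.min; case: (ltP b x) => ?; case: ltP => ?;
    by apply/andP; split; lra.
have c_id x : a <= x <= b -> c x = x.
  by rewrite /c => /andP[ax xb]; rewrite min_r// max_r.
have c_lip x y : `|c x - c y| <= `|x - y|.
  wlog xy : x y / x <= y.
    move=> H; have [|/ltW] := leP x y; first exact: H.
    by move=> yx; rewrite (distrC (c x)) (distrC x); exact: H.
  rewrite (distrC (c x)) (distrC x) [leRHS]ger0_norm ?subr_ge0// ler_norml.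
  by rewrite /c /Num.max /Num.min; case: (ltP b x) => ?; case: (ltP b y) => ?;
    do 2 case: ltP => ?; apply/andP; split; lra.
have L_ge0 : 0 <= L.
  rewrite -(pmulr_lge0 (x := `|a - b|)); last first.
    by rewrite normr_gt0 subr_eq0 lt_eqF.
  by apply: le_trans (F_lip a b _ _) => //; rewrite ?lexx ltW.
rewrite -{2}(c_id b) ?lexx ?ltW// -{2}(c_id a) ?lexx ?ltW//.
apply: (@lipschitzT_FTC R (F \o c) L _ G a b ab).
  move=> x y /=; apply: le_trans (F_lip _ _ (cab x) (cab y)) _.
  by rewrite ler_wpM2l.
apply: filterS FG => t FGt atb.
by apply: is_derive_interval_eq atb _ (FGt atb) => x /c_id /= ->.
Qed.

(** Neither this nor the previous lemma holds for mere continuity of [F], as the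
Cantor function shows. *)
Lemma lipschitz_growth_le (R : realType) (F : R -> R) (L c a b : R) : a < b ->
  (forall x y, a <= x <= b -> a <= y <= b -> `|F x - F y| <= L * `|x - y|) ->
  {ae lebesgue_measure, forall t : R, a < t < b ->
    exists2 d, is_derive t 1 F d & d <= c} ->
  F b - F a <= c * (b - a).
Proof.
move=> ab F_lip dF.
pose K x := F x - c * x; pose G t := 'D_1 K t.
have dK : {ae lebesgue_measure, forall t : R, a < t < b ->
    is_derive t 1 K (G t) /\ G t <= 0}.
  apply: filterS dF => t dFt /dFt[d Fd dc].
  have Kd : is_derive t 1 K (d - c).
    have Hid := is_derive_id t (1 : R).
    have := is_deriveB Fd (is_deriveZ c Hid).
    by rewrite /GRing.scale /= mulr1.
  have -> : G t = d - c by exact: derive_val.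
  by split => //; rewrite subr_le0.
have : ((K b - K a)%:E <= 0)%E.
  rewrite -(@lipschitz_FTC R K G (L + `|c|) a b ab); last 2 first.
  - move=> x y xab yab; rewrite /K.
    apply: (@le_trans _ _ (`|F x - F y| + `|c * (x - y)|)).
      rewrite (_ : _ + _ = (F x - F y) - c * (x - y)); last ring.
      exact: ler_normB.
    by rewrite mulrDl lerD// ?F_lip// normrM.
  - by apply: filterS dK => t dKt /dKt[].
  (* Truncating [G] changes it on a negligible set only and makes its sign
     hold everywhere. *)
  pose f t := (- Num.min (G t) 0)%:E.
  have f_ge0 t : (0 <= f t)%E by rewrite lee_fin oppr_ge0 ge_min lexx orbT.
  have -> : (\int[lebesgue_measure]_(t in `]a, b[) (G t)%:E =
      \int[lebesgue_measure]_(t in `]a, b[) - f t)%E.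
    apply: eq_integral_ae; apply: filterS dK => t dKt; rewrite !patchE.
    case: ifPn => //; rewrite inE/= in_itv/= => /dKt[_ G0].
    by rewrite /f /= opprK min_l.
  have -> : (\int[lebesgue_measure]_(t in `]a, b[) - f t =
      - \int[lebesgue_measure]_(t in `]a, b[) f t)%E by exact: integral_ge0N.
  by rewrite oppe_le0; exact: integral_ge0.
rewrite lee_fin /K; lra.
Qed.

(** * The Euclidean inner product *)

Section dot_product.
Context (R : realType) (n : nat).
Implicit Types x y z : 'rV[R]_n.

Lemma dotC x y : dot x y = dot y x.
Proof. by apply: eq_bigr => i _; rewrite mulrC. Qed.

Lemma dotDl x y z : dot (x + y) z = dot x z + dot y z.
Proof. by rewrite -big_split/=; apply: eq_bigr => i _; rewrite mxE mulrDl. Qed.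

Lemma dotZl a x y : dot (a *: x) y = a * dot x y.
Proof. by rewrite big_distrr/=; apply: eq_bigr => i _; rewrite mxE mulrA. Qed.

Lemma dotNl x y : dot (- x) y = - dot x y.
Proof. by rewrite -scaleN1r dotZl mulN1r. Qed.

Lemma dotBl x y z : dot (x - y) z = dot x z - dot y z.
Proof. by rewrite dotDl dotNl. Qed.

Lemma dotDr x y z : dot x (y + z) = dot x y + dot x z.
Proof. by rewrite !(dotC x) dotDl. Qed.

Lemma dotZr a x y : dot x (a *: y) = a * dot x y.
Proof. by rewrite !(dotC x) dotZl. Qed.

Lemma dotNr x y : dot x (- y) = - dot x y.
Proof. by rewrite !(dotC x) dotNl. Qed.

Lemma dotBr x y z : dot x (y - z) = dot x y - dot x z.
Proof. by rewrite !(dotC x) dotBl. Qed.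

Lemma dot0r x : dot x 0 = 0.
Proof. by rewrite -(scale0r 0) dotZr mul0r. Qed.

Lemma dot_ge0 x : 0 <= dot x x.
Proof. by apply: sumr_ge0 => i _; rewrite -expr2 sqr_ge0. Qed.

Lemma sqr_coord_le_dot x i : x ord0 i ^+ 2 <= dot x x.
Proof.
rewrite /dot (bigD1 i)//= -expr2 lerDl.
by apply: sumr_ge0 => j _; rewrite -expr2 sqr_ge0.
Qed.

Lemma dot_eq0 x : dot x x = 0 -> x = 0.
Proof.
move=> xx0; apply/rowP => i; rewrite mxE; apply/eqP.
by rewrite -sqrf_eq0 eq_le sqr_ge0 -xx0 sqr_coord_le_dot.
Qed.

Lemma coord_le_norm x i : `|x ord0 i| <= `|x|.
Proof.
rewrite [leRHS]/Num.Def.normr/= mx_normrE.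
exact: (le_bigmax _ (fun ij => `|x ij.1 ij.2|) (ord0, i)).
Qed.

(** A Cauchy-Schwarz inequality for the sup norm, whence the factor [n]. *)
Lemma ler_norm_dot x y : `|dot x y| <= n%:R * (`|x| * `|y|).
Proof.
rewrite -[n in n%:R]card_ord -sum1_card natr_sum mulr_suml.
apply: le_trans (ler_norm_sum _ _ _) _; apply: ler_sum => i _.
by rewrite mul1r normrM ler_pM// coord_le_norm.
Qed.

Lemma cvg_dot (T : Type) (F : set_system T) (FF : Filter F)
    (u v : T -> 'rV[R]_n) (x y : 'rV[R]_n) :
  u @ F --> x -> v @ F --> y -> (fun t => dot (u t) (v t)) @ F --> dot x y.
Proof.
move=> ux vy; rewrite /dot.
apply: (@cvg_big R^o) => [|i _]; first exact: add_continuous.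
apply: cvgM.
- apply: (cvg_comp u (fun M : 'rV[R]_n => M ord0 i)) ux _.
  exact: coord_continuous.
- apply: (cvg_comp v (fun M : 'rV[R]_n => M ord0 i)) vy _.
  exact: coord_continuous.
Qed.

Lemma compact_dot_bounded (A : set 'rV[R]_n) (M : R) :
  closed A -> (forall x, A x -> dot x x <= M) -> compact A.
Proof.
move=> clA AM; apply: bounded_closed_compact => //.
exists (Num.sqrt M); split => [|m Mm x Ax /=]; first exact: num_real.
rewrite [leLHS]/Num.Def.normr/= mx_normrE.
apply: bigmax_le => [|ij _]; first exact: le_trans (sqrtr_ge0 _) (ltW Mm).
apply: le_trans (ltW Mm); rewrite -sqrtr_sqr ler_wsqrtr//.
by rewrite (ord1 ij.1); apply: le_trans (sqr_coord_le_dot _ _) (AM _ Ax).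
Qed.

Lemma is_derive_dot (u v : R -> 'rV[R]_n) (t : R) :
  derivable u t 1 -> derivable v t 1 ->
  is_derive t 1 (fun s => dot (u s) (v s))
    (dot (derive1 u t) (v t) + dot (u t) (derive1 v t)).
Proof.
move=> du dv.
have dcoord (w : R -> 'rV[R]_n) i : derivable w t 1 ->
    is_derive t 1 (fun s => w s ord0 i) (derive1 w t ord0 i).
  move=> dw; rewrite derive1E derive_mx// mxE; apply: derivableP.
  by move/derivable_mxP : dw; exact.
rewrite /dot -big_split/=.
have -> : (fun s => \sum_(i < n) u s ord0 i * v s ord0 i) =
    \sum_(i < n) (fun s => u s ord0 i * v s ord0 i).
  by apply/funext => s; rewrite fct_sumE.
apply: is_derive_sum => i.
have := is_deriveM (dcoord u i du) (dcoord v i dv).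
by rewrite /GRing.scale/= addrC [_ * derive1 u t _ _]mulrC.
Qed.

Lemma is_derive_dotl (u : R -> 'rV[R]_n) (g : 'rV[R]_n) (t : R) :
  derivable u t 1 -> is_derive t 1 (fun s => dot (u s) g) (dot (derive1 u t) g).
Proof.
move=> du; have := is_derive_dot du (derivable_cst g t 1).
by rewrite derive1_cst dot0r addr0.
Qed.

End dot_product.

(** * Convex absolutely one-homogeneous functions are seminorms *)

Section seminorm.
Context (R : realType) (n : nat) (J : 'rV[R]_n -> R).
Context (J_ge0 : forall x, 0 <= J x)
  (J_convex : convex_function [set: 'rV[R]_n] (J : 'rV[R]_n -> R^o))
  (J_hom : abs_one_homogeneous J).

Lemma homogeneous0 : J 0 = 0.
Proof. by rewrite -(scale0r 0) J_hom normr0 mul0r. Qed.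

Lemma homogeneousN x : J (- x) = J x.
Proof. by rewrite -scaleN1r J_hom normrN1 mul1r. Qed.

(** Convexity at the midpoint bounds [J ((x + y) / 2) = J (x + y) / 2] by
[(J x + J y) / 2]. *)
Lemma subadditive x y : J (x + y) <= J x + J y.
Proof.
have h0 : 0 <= 2^-1 :> R by rewrite invr_ge0.
have h1 : 2^-1 <= 1 :> R by rewrite invf_le1// ler1n.
have : J (2^-1 *: x + (1 - 2^-1) *: y) <= 2^-1 * J x + (1 - 2^-1) * J y.
  have := J_convex (Itv01 h0 h1).
  by move=> /(_ x y (mem_set I) (mem_set I)).
have -> : 1 - 2^-1 = 2^-1 :> R by lra.
rewrite -scalerDr J_hom ger0_norm// -mulrDr.
by rewrite ler_pM2l// invr_gt0.
Qed.

Lemma homogeneous_bound : exists2 M, 0 <= M & forall x, J x <= M * `|x|.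
Proof.
exists (\sum_(i < n) J (delta_mx ord0 i)) => [|x]; first exact: sumr_ge0.
have J_sum (I : Type) (r : seq I) (v : I -> 'rV[R]_n) :
    J (\sum_(i <- r) v i) <= \sum_(i <- r) J (v i).
  elim: r => [|i r IH]; first by rewrite !big_nil homogeneous0.
  by rewrite !big_cons (le_trans (subadditive _ _))// lerD2l.
rewrite {1}(row_sum_delta x) (le_trans (J_sum _ _ _))// mulr_suml.
apply: ler_sum => i _; rewrite J_hom mulrC ler_wpM2l//.
exact: coord_le_norm.
Qed.

Lemma homogeneous_continuous : continuous J.
Proof.
have [M M0 JM] := homogeneous_bound.
have M1 : 0 < M + 1 by rewrite ltr_wpDl.
have J_lip x y : J x - J y <= M * `|x - y|.
  rewrite (le_trans _ (JM _))// lerBlDr.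
  by rewrite -{1}(subrK y x) subadditive.
move=> x; have FF := nbhs_filter x; apply/cvgrPdist_le => e e0.
apply/(@nbhs_normP R 'rV[R]_n); exists (e / (M + 1)) => [|y /ltW xy] /=.
  by rewrite divr_gt0.
apply: (@le_trans _ _ ((M + 1) * `|x - y|)).
  apply: (@le_trans _ _ (M * `|x - y|)); last by rewrite ler_wpM2r// lerDl.
  by rewrite ler_norml J_lip lerNl opprB distrC J_lip.
by rewrite mulrC -ler_pdivlMr.
Qed.

Lemma nullspaceD x y : nullspace J x -> nullspace J y -> nullspace J (x + y).
Proof.
move=> /= x0 y0; apply/eqP; rewrite eq_le J_ge0 andbT.
by rewrite (le_trans (subadditive _ _))// x0 y0 addr0.
Qed.

Lemma nullspaceZ a x : nullspace J x -> nullspace J (a *: x).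
Proof. by rewrite /nullspace /= J_hom => ->; rewrite mulr0. Qed.

Lemma nullspaceN x : nullspace J x -> nullspace J (- x).
Proof. by rewrite /nullspace /= homogeneousN. Qed.

Lemma closed_preimage (g : 'rV[R]_n -> R) (B : set R) :
  continuous g -> closed B -> closed (g @^-1` B).
Proof. by move=> cg clB; apply: closed_comp => // x _; exact: cg. Qed.

(** The projection is the point of [N] nearest to [f]. Points of [N] farther from
[f] than [0] can be discarded, which leaves a compact set; orthogonality is the
first-order condition for the minimum along each direction of [N]. *)
Lemma orth_proj_nullspace f : let y := orth_proj (nullspace J) f in
  nullspace J y /\ forall z, nullspace J z -> dot (f - y) z = 0.
Proof.
apply: (@xgetPex _ 0
  [set y | nullspace J y /\ forall z, nullspace J z -> dot (f - y) z = 0]).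
pose q y := dot (f - y) (f - y).
have cq : continuous q.
  move=> y; have FF := nbhs_filter y.
  by apply: cvg_dot; apply: cvgB;
    [exact: cvg_cst|exact: cvg_id|exact: cvg_cst|exact: cvg_id].
pose A := [set y | nullspace J y /\ q y <= dot f f].
have cA : compact A.
  apply: (@compact_dot_bounded _ _ _ (4 * dot f f)).
    apply: closedI.
      apply: (closed_preimage homogeneous_continuous (B := [set 0])).
      exact: closed_eq.
    exact: (closed_preimage cq (@closed_le _ _)).
  (* Parallelogram law for [f] and [f - y]. *)
  move=> y [_]; rewrite /q.
  have := dot_ge0 (f + f - y).
  rewrite !(dotBl, dotBr, dotDl, dotDr) (dotC y f); lra.
have [|y] := EVT_min_rV _ cA (continuous_subspaceT cq).
  by exists 0; split; [exact: homogeneous0|rewrite /q subr0].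
rewrite inE => -[Jy qy] y_min; exists y; split => // z Jz.
set d := dot (f - y) z; set Z := dot z z.
have Z_ge0 : 0 <= Z by exact: dot_ge0.
have qs s : q y <= q y - 2 * s * d + s ^+ 2 * Z.
  have -> : q y - 2 * s * d + s ^+ 2 * Z = q (y + s *: z).
    rewrite /q opprD addrA /d; set a := f - y.
    rewrite (dotBl a (s *: z)) !(dotBr _ a) !dotZr !dotZl (dotC z) -/Z; ring.
  have [|/ltW] := leP (q (y + s *: z)) (dot f f); last exact: le_trans.
  move=> qf; apply: y_min; rewrite inE; split => //.
  by apply: nullspaceD => //; exact: nullspaceZ.
(* The quadratic in [s] is minimal at [s = d / Z]; the shift by 1 avoids a
   division by zero and still makes it negative unless [d = 0]. *)
have := qs (d / (Z + 1)); rewrite -addrA lerDl => h.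
apply/eqP; rewrite -sqrf_eq0 eq_le sqr_ge0 andbT.
have Z1 : 0 < Z + 1 by rewrite ltr_wpDl.
have : 0 <= - d ^+ 2 * (Z + 2).
  have := mulr_ge0 h (sqr_ge0 (Z + 1)).
  rewrite (_ : _ * _ = - d ^+ 2 * (Z + 2))//.
  by field; exact: lt0r_neq0.
by rewrite mulNr oppr_ge0 pmulr_lle0// ltr_wpDl.
Qed.

(** On the compact unit sphere [K] of the orthogonal complement of [N], the
continuous function [J] has a minimum, which is positive because [N] does not
meet [K]. *)
Lemma orthogonal_coercive : exists2 c, 0 < c & forall x,
  (forall z, nullspace J z -> dot x z = 0) -> c * Num.sqrt (dot x x) <= J x.
Proof.
pose K := [set x | (forall z, nullspace J z -> dot x z = 0) /\ dot x x = 1].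
have normalize x : (forall z, nullspace J z -> dot x z = 0) -> dot x x != 0 ->
    K ((Num.sqrt (dot x x))^-1 *: x).
  move=> xN x0; split => [z /xN xz|]; first by rewrite dotZl xz mulr0.
  rewrite dotZl dotZr mulrA -invfM -expr2 sqr_sqrtr ?dot_ge0//.
  by rewrite mulVf.
have [K0|K0] := pselect (K !=set0); last first.
  (* The complement is zero. *)
  exists 1 => // x xN.
  have [->|x0] := eqVneq (dot x x) 0; first by rewrite sqrtr0 mulr0.
  by case: K0; exists ((Num.sqrt (dot x x))^-1 *: x); exact: normalize.
have cK : compact K.
  apply: (@compact_dot_bounded _ _ _ 1) => [|x [_ ->]//].
  apply: closedI; last first.
    apply: (closed_preimage (g := fun x => dot x x)) (@closed_eq _ _) => x.
    have FF := nbhs_filter x.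
    by apply: cvg_dot; exact: cvg_id.
  have -> : (fun x => forall z, nullspace J z -> dot x z = 0) =
      \bigcap_(z in nullspace J) ((fun x => dot x z) @^-1` [set 0]) by [].
  apply: closed_bigI => z _.
  apply: (closed_preimage (g := fun x => dot x z)) (@closed_eq _ _) => x.
  have FF := nbhs_filter x.
  by apply: cvg_dot; [exact: cvg_id|exact: cvg_cst].
have [x] := EVT_min_rV K0 cK (continuous_subspaceT homogeneous_continuous).
rewrite inE => -[xN xx1] x_min; exists (J x).
  rewrite lt_neqAle J_ge0 andbT eq_sym; apply/eqP => /xN/eqP.
  by rewrite xx1 oner_eq0.
move=> y yN; have [->|y0] := eqVneq (dot y y) 0; first by rewrite sqrtr0 mulr0.
have := x_min _ (mem_set (normalize y yN y0)).
have s0 : 0 < Num.sqrt (dot y y).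
  by rewrite sqrtr_gt0 lt_neqAle eq_sym y0 dot_ge0.
by rewrite J_hom gtr0_norm ?invr_gt0// mulrC ler_pdivlMr.
Qed.

(** Moving from [x] along [z] in [N] does not increase [J]. *)
Lemma subgradient_orthogonal x p z :
  subdifferential J x p -> nullspace J z -> dot p z = 0.
Proof.
have main z' : subdifferential J x p -> nullspace J z' -> dot p z' <= 0.
  move=> px z'0; have := px (x + z'); rewrite addrAC subrr add0r => h.
  rewrite -(lerD2l (J x)) addr0 (le_trans h)//.
  by rewrite (le_trans (subadditive _ _))// z'0 addr0.
move=> px z0; apply/eqP; rewrite eq_le main//= -oppr_le0 -dotNr main//.
exact: nullspaceN.
Qed.

(** The subgradient inequality is used at the point [y], where [J] vanishes. *)
Lemma subgradient_dot_ge x p y :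
  subdifferential J x p -> nullspace J y -> J (x - y) <= dot p (x - y).
Proof.
move=> px Jy0; have := px y; rewrite Jy0 -opprB dotNr subr_le0.
apply: le_trans; rewrite (le_trans (subadditive _ _))//.
by rewrite homogeneousN// Jy0 addr0.
Qed.

End seminorm.

(** * Finite extinction of the gradient flow *)

Section flow.
Context (R : realType) (n : nat).

Lemma gradient_flow_lipschitz (J : 'rV[R]_n -> R) f u :
  gradient_flow J f u ->
  exists2 L, 0 <= L &
    forall x y, 0 <= x -> 0 <= y -> `|u x - u y| <= L * `|x - y|.
Proof.
move=> [/pinfty_ex_gt0[L L0 uL] _ _]; exists L; first exact: ltW.
by move=> x y x0 y0; apply: (uL (x, y)); split; rewrite /= in_itv/= andbT.
Qed.

Lemma gradient_flow_dot_lipschitz (J : 'rV[R]_n -> R) f u g :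
  gradient_flow J f u -> exists L, forall x y, 0 <= x -> 0 <= y ->
    `|dot (u x) g - dot (u y) g| <= L * `|x - y|.
Proof.
move=> /gradient_flow_lipschitz[L L0 uL].
exists (n%:R * (L * `|g|)) => x y x0 y0.
rewrite -dotBl (le_trans (ler_norm_dot _ _))// -mulrA ler_wpM2l//.
by rewrite mulrAC ler_wpM2r// uL.
Qed.

Context (J : 'rV[R]_n -> R) (f : 'rV[R]_n) (u : R -> 'rV[R]_n).
Context (J_ge0 : forall x : 'rV[R]_n, 0 <= J x)
  (J_convex : convex_function [set: 'rV[R]_n] (J : 'rV[R]_n -> R^o))
  (J_hom : abs_one_homogeneous J) (u_GF : gradient_flow J f u).

Let y0 := orth_proj (nullspace J) f.

Let y0_null : nullspace J y0.
Proof. by have [] := orth_proj_nullspace J_ge0 J_convex J_hom f. Qed.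

Let y0_orth z : nullspace J z -> dot (f - y0) z = 0.
Proof. by have [_] := orth_proj_nullspace J_ge0 J_convex J_hom f; exact. Qed.

Let u0 : u 0 = f. Proof. by case: u_GF. Qed.

(** [f - y0] is orthogonal to [N], and the velocity, being minus a subgradient,
keeps [u - y0] so. *)
Lemma flow_orthogonal t z : 0 <= t -> nullspace J z -> dot (u t - y0) z = 0.
Proof.
have [_ _ du] := u_GF.
have main z' T : 0 < T -> nullspace J z' -> dot (u T - y0) z' <= 0.
  move=> T0 z'0; have [L uL] := gradient_flow_dot_lipschitz z' u_GF.
  have : dot (u T) z' - dot (u 0) z' <= 0 * (T - 0).
    apply: (lipschitz_growth_le (F := fun s => dot (u s) z') (L := L)) => //.
      by move=> x y /andP[x0 _] /andP[y_ge0 _]; exact: uL.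
    apply: filterS du => s dus /andP[/dus[uds ps] _].
    exists (dot (derive1 u s) z'); first exact: is_derive_dotl.
    by rewrite -oppr_ge0 -dotNl (subgradient_orthogonal J_convex J_hom ps z'0).
  rewrite mul0r -dotBl u0 => h.
  by rewrite -(subrK f (u T)) -addrA dotDl (y0_orth z'0) addr0.
rewrite le_eqVlt => /predU1P[<- z0|t0 z0]; first by rewrite u0 y0_orth.
apply/eqP; rewrite eq_le main//= -oppr_le0 -dotNr main//.
exact: nullspaceN.
Qed.

Let phi t := dot (u t - y0) (u t - y0).

(** The square is Lipschitz on bounded intervals only. *)
Let phi_lip T : exists L, forall x y, 0 <= x <= T -> 0 <= y <= T ->
  `|phi x - phi y| <= L * `|x - y|.
Proof.
have [L L0 uL] := gradient_flow_lipschitz u_GF; set C := `|f - y0| + L * T.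
exists (n%:R * L * (C + C)) => x y /andP[x0 xT] /andP[y_ge0 yT].
have w_le s : 0 <= s <= T -> `|u s - y0| <= C.
  move=> /andP[s0 sT]; rewrite -(subrK f (u s)) -addrA addrC.
  rewrite (le_trans (ler_normD _ _))// lerD2l -u0 (le_trans (uL _ _ _ _))//.
  by rewrite subr0 ger0_norm// ler_wpM2l.
have -> : phi x - phi y = dot (u x - u y) ((u x - y0) + (u y - y0)).
  have -> : u x - u y = (u x - y0) - (u y - y0) by rewrite opprB addrA subrK.
  rewrite /phi; move: (u x - y0) (u y - y0) => a b.
  by rewrite dotBl !dotDr (dotC b a); ring.
rewrite (le_trans (ler_norm_dot _ _))// -!mulrA ler_wpM2l//.
rewrite [_ * `|x - y|]mulrC mulrA ler_pM// ?uL//.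
by rewrite (le_trans (ler_normD _ _))// lerD// w_le ?x0 ?y_ge0.
Qed.

(** [phi' = - 2 p . (u - y0) <= - 2 J (u - y0)]. *)
Let phi_decay : exists2 c, 0 < c &
  {ae lebesgue_measure, forall t : R, 0 < t ->
    exists2 d, is_derive t 1 phi d & d <= - 2 * c * Num.sqrt (phi t)}.
Proof.
have [c c0 Jc] := orthogonal_coercive J_ge0 J_convex J_hom; exists c => //.
have [_ _ du] := u_GF; apply: filterS du => t dut t0.
have [dt pt] := dut t0.
pose w := u - cst y0.
have dw : derivable w t 1 := derivableB dt (derivable_cst y0 t 1).
have dwE : derive1 w t = derive1 u t.
  by rewrite !derive1E (deriveB dt (derivable_cst y0 t 1)) derive_cst subr0.
exists (dot (derive1 w t) (w t) + dot (w t) (derive1 w t)).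
  exact: (is_derive_dot dw dw).
have -> : phi t = dot (w t) (w t) by [].
have wE : w t = u t - y0 by [].
rewrite dwE (dotC (w t) (derive1 u t)) -mulr2n -[_ *+ 2]mulr_natl.
rewrite -mulrA mulNr -mulrN.
rewrite ler_wpM2l// lerNr -dotNl wE.
apply: le_trans (subgradient_dot_ge J_convex J_hom pt y0_null); apply: Jc => z.
by apply: flow_orthogonal; exact: ltW.
Qed.

(** If [phi t > 0] then [phi >= phi t] on [[0, t]], where the square root is
therefore Lipschitz; so [sqrt phi] is Lipschitz there with derivative at most
[- c], and [0 < sqrt (phi t) <= sqrt (phi 0) - c t] bounds [t]. *)
Lemma finite_extinction : exists2 T, 0 < T & forall t, T <= t -> u t = y0.
Proof.
have [c c0 dphi] := phi_decay.
have phi_ge0 t : 0 <= phi t by exact: dot_ge0.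
have phi_noninc s t : 0 <= s -> s <= t -> phi t <= phi s.
  move=> s0; rewrite le_eqVlt => /predU1P[->//|st]; rewrite -subr_le0.
  have [L phiL] := phi_lip t.
  rewrite -[leRHS](mul0r (t - s)).
  apply: (lipschitz_growth_le (F := phi) (L := L)) => //.
    move=> x y /andP[sx xt] /andP[sy yt].
    by apply: phiL; rewrite ?xt ?yt (le_trans s0).
  apply: filterS dphi => r dr /andP[sr rt].
  have [|d rd dle] := dr; first exact: le_lt_trans sr.
  exists d => //; apply: le_trans dle _.
  by rewrite mulNr mulNr oppr_le0 mulr_ge0 ?sqrtr_ge0// mulr_ge0// ltW.
pose T := Num.sqrt (phi 0) / c + 1.
have T0 : 0 < T by rewrite ltr_wpDl// divr_ge0 ?sqrtr_ge0// ltW.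
exists T => // t Tt; have t0 : 0 < t by exact: lt_le_trans Tt.
apply/eqP; rewrite -subr_eq0; apply/eqP/dot_eq0; rewrite -/(phi t).
apply/eqP; apply: contraT => phit.
have {}phit : 0 < phi t by rewrite lt_neqAle eq_sym phit phi_ge0.
pose psi s := Num.sqrt (phi s).
have phi_ge s : 0 <= s <= t -> phi t <= phi s.
  by move=> /andP[]; exact: phi_noninc.
have psi_ge s : 0 <= s <= t -> psi t <= psi s.
  by move=> /phi_ge; exact: ler_wsqrtr.
have psit : 0 < psi t by rewrite sqrtr_gt0.
have [L phiL] := phi_lip t.
have : psi t - psi 0 <= - c * (t - 0).
  apply: (lipschitz_growth_le (F := psi) (L := L / psi t)) => //.
    (* [|phi x - phi y| = |psi x - psi y| (psi x + psi y)]. *)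
    move=> x y xt yt; rewrite mulrAC ler_pdivlMr//.
    apply: le_trans (phiL x y xt yt).
    rewrite -[phi x]sqr_sqrtr// -[phi y]sqr_sqrtr// -/(psi x) -/(psi y).
    rewrite subr_sqr normrM ler_wpM2l// ger0_norm ?addr_ge0 ?sqrtr_ge0//.
    by rewrite (le_trans (psi_ge _ xt))// lerDl sqrtr_ge0.
  apply: filterS dphi => s ds /andP[s0 st].
  have st' : 0 <= s <= t by rewrite !ltW.
  have [//|d sd dle] := ds.
  have psis : 0 < psi s by exact: lt_le_trans (psi_ge _ st').
  have phis : 0 < phi s by exact: lt_le_trans (phi_ge _ st').
  exists ((2 * psi s)^-1 * d).
    exact: (@is_derive1_comp R (@Num.sqrt R) phi s _ _
      (is_derive1_sqrt phis) sd).
  rewrite ler_pdivrMl ?mulr_gt0//; apply: le_trans dle _.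
  by rewrite le_eqVlt; apply/orP; left; apply/eqP; rewrite -/(psi s); ring.
rewrite subr0 => h.
have : psi 0 < c * t.
  rewrite mulrC -ltr_pdivrMr//; apply: lt_le_trans Tt.
  by rewrite ltrDl.
move=> h2; have := psit; lra.
Qed.

End flow.

(** * The spectral representation *)

Theorem theorem3 (R : realType) (n : nat) (J : 'rV[R]_n -> R)
    (J_ge0 : forall x : 'rV[R]_n, 0 <= J x)
    (J_convex : convex_function [set: 'rV[R]_n] (J : 'rV[R]_n -> R^o))
    (J_lsc : lower_semicontinuous (fun x : 'rV[R]_n => (J x)%:E))
    (J_hom : abs_one_homogeneous J)
    (f : 'rV[R]_n) (u : R -> 'rV[R]_n) (u_GF : gradient_flow J f u) :
  exists2 w : 'rV[R]_n, is_spectral_integral u w &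
    f = orth_proj (nullspace J) f + w.
Proof.
set y0 := orth_proj _ f; exists (f - y0) => [g|]; last by rewrite addrC subrK.
have [T T0 uT] := finite_extinction J_ge0 J_convex J_hom u_GF.
have [L uL] := gradient_flow_dot_lipschitz g u_GF.
have [_ u0 du] := u_GF.
pose F t := dot (u t) g.
have FTC : (\int[lebesgue_measure]_(t in `]0%R, T[) (dot (derive1 u t) g)%:E =
    (F T - F 0)%:E)%E.
  apply: (lipschitz_FTC (L := L)) => //.
    by move=> x y /andP[x0 _] /andP[y_ge0 _]; exact: uL.
  apply: filterS du => s dus /andP[/dus[uds _] _].
  exact: is_derive_dotl.
rewrite /spectral_functional.
have -> : (\int[lebesgue_measure]_(t in `[0%R, +oo[)
       (dot (t *: derive1 (fun=> g) t + g) (derive1 u t))%:E =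
   \int[lebesgue_measure]_(t in `]0%R, T[) (dot (derive1 u t) g)%:E)%E.
  apply: eq_integral_ae.
  apply: filterS2 (ae_neq 0) (ae_neq T) => t /eqP t0 /eqP tT.
  rewrite !patchE derive1_cst scaler0 add0r.
  case: ifPn => [|]; rewrite ?notin_setE ?inE/= !in_itv/= ?andbT => t_ge0;
    last first.
    case: ifPn => //; rewrite inE/= in_itv/= => /andP[/ltW t0'].
    by rewrite t0' in t_ge0.
  case: ifPn => [|]; rewrite ?notin_setE ?inE/= in_itv/= => tT'.
    by rewrite dotC.
  have {}tT : T < t.
    rewrite lt_neqAle eq_sym tT leNgt; apply/negP => ltT.
    by move: tT'; rewrite ltT lt0r t0 t_ge0.
  (* Past [T] the flow is constant, so its velocity is zero. *)
  rewrite derive1E (near_eq_derive (g := cst y0)).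
    by rewrite derive_cst dot0r.
  by near=> s; apply: uT; apply: ltW; near: s; exact: lt_nbhsr.
by rewrite FTC -EFinN /F -dotBl (uT T)// u0 -dotNl opprB.
Unshelve. all: by end_near. Qed.
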